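(* Let $\Omega_c$ be a commutative semigroup, let $(A,\cdot_{\omega_1,\omega_2},\Omega_c)$ be an $\Omega_c$-relative anti-flexible algebra, and let $(R_\alpha)_{\alpha\in\Omega_c}$ be a Rota-Baxter operator on it. Then the operations $$x\prec_{\alpha,\beta}y := x\cdot_{\alpha,\beta}R_\beta(y),\qquad x\succ_{\alpha,\beta}y := R_\alpha(x)\cdot_{\alpha,\beta}y\qquad(x,y\in A,\ \alpha,\beta\in\Omega_c)$$ make $A$ an $\Omega_c$-relative pre-anti-flexible algebra.
   Context: Standing conventions: $\Omega_c$ is a commutative associative semigroup; $A$ is a finite-dimensional vector space over a field of characteristic zero; all operations on $A$ are bilinear. In the following identities $x,y,z\in A$ and $\alpha,\beta,\gamma\in\Omega_c$ are arbitrary. $\Omega_c$-relative anti-flexible algebra: operations $\cdot_{\alpha,\beta}$ ($(\alpha,\beta)\in\Omega_c^2$) with $$(x\cdot_{\alpha,\beta}y)\cdot_{\alpha\beta,\gamma}z - x\cdot_{\alpha,\beta\gamma}(y\cdot_{\beta,\gamma}z) = (z\cdot_{\gamma,\beta}y)\cdot_{\gamma\beta,\alpha}x - z\cdot_{\gamma,\beta\alpha}(y\cdot_{\beta,\alpha}x).$$ Rota-Baxter operator on an $\Omega_c$-relative anti-flexible algebra: a family of linear maps $R_\alpha:A\to A$ ($\alpha\in\Omega_c$) with $$R_\alpha(x)\cdot_{\alpha,\beta}R_\beta(y) = R_{\alpha\beta}\bigl(R_\alpha(x)\cdot_{\alpha,\beta}y + x\cdot_{\alpha,\beta}R_\beta(y)\bigr).$$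 $\Omega_c$-relative pre-anti-flexible algebra: operations $\prec_{\alpha,\beta},\succ_{\alpha,\beta}$ ($(\alpha,\beta)\in\Omega_c^2$) with $$(x\succ_{\alpha,\beta}y)\prec_{\alpha\beta,\gamma}z - x\succ_{\alpha,\beta\gamma}(y\prec_{\beta,\gamma}z) = (z\succ_{\gamma,\beta}y)\prec_{\gamma\beta,\alpha}x - z\succ_{\gamma,\beta\alpha}(y\prec_{\beta,\alpha}x),$$ $$(x\prec_{\alpha,\beta}y + x\succ_{\alpha,\beta}y)\succ_{\alpha\beta,\gamma}z - x\succ_{\alpha,\beta\gamma}(y\succ_{\beta,\gamma}z) = (z\prec_{\gamma,\beta}y)\prec_{\gamma\beta,\alpha}x - z\prec_{\gamma,\beta\alpha}(y\prec_{\beta,\alpha}x + y\succ_{\beta,\alpha}x).$$ *)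

(* Defs.v *)
From HB Require Import structures.
From mathcomp Require Import all_boot all_order all_algebra.

Set Implicit Arguments.
Unset Strict Implicit.
Unset Printing Implicit Defensive.

Import GRing.Theory.
Local Open Scope ring_scope.

(* The commutative semigroup is a plain type [Omega] with a bundled
   associative and commutative operation [m]; no unit, decidable equality or
   inhabitant is assumed.  Structures on [A] are predicates on families of
   operations, so bilinearity (resp. linearity) is part of each predicate. *)

Definition bilinear_op (K : fieldType) (A : vectType K) (f : A -> A -> A) : Prop :=
  bilinear_for *:%R *:%R f.

Record relative_antiflexible (Omega : Type) (m : SemiGroup.com_law Omega)
    (K : fieldType) (A : vectType K) (op : Omega -> Omega -> A -> A -> A) : Prop :=
  RelativeAntiflexible {
    raf_bilinear : forall a b, bilinear_op (op a b);
    raf_assoc_sym : forall (a b c : Omega) (x y z : A),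
      op (m a b) c (op a b x y) z - op a (m b c) x (op b c y z)
      = op (m c b) a (op c b z y) x - op c (m b a) z (op b a y x)
  }.

Record relative_Rota_Baxter (Omega : Type) (m : SemiGroup.com_law Omega)
    (K : fieldType) (A : vectType K) (op : Omega -> Omega -> A -> A -> A)
    (R : Omega -> A -> A) : Prop :=
  RelativeRotaBaxter {
    rrb_linear : forall a, linear (R a);
    rrb_identity : forall (a b : Omega) (x y : A),
      op a b (R a x) (R b y) = R (m a b) (op a b (R a x) y + op a b x (R b y))
  }.

Record relative_pre_antiflexible (Omega : Type) (m : SemiGroup.com_law Omega)
    (K : fieldType) (A : vectType K)
    (prec succ : Omega -> Omega -> A -> A -> A) : Prop :=
  RelativePreAntiflexible {
    rpaf_prec_bilinear : forall a b, bilinear_op (prec a b);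
    rpaf_succ_bilinear : forall a b, bilinear_op (succ a b);
    rpaf_middle : forall (a b c : Omega) (x y z : A),
      prec (m a b) c (succ a b x y) z - succ a (m b c) x (prec b c y z)
      = prec (m c b) a (succ c b z y) x - succ c (m b a) z (prec b a y x);
    rpaf_outer : forall (a b c : Omega) (x y z : A),
      succ (m a b) c (prec a b x y + succ a b x y) z
        - succ a (m b c) x (succ b c y z)
      = prec (m c b) a (prec c b z y) x
        - prec c (m b a) z (prec b a y x + succ b a y x)
  }.

(* Main.v *)
Require Import Defs.
From mathcomp Require Import all_boot all_order all_algebra.

Import GRing.Theory.
Local Open Scope ring_scope.

(** Both axioms are instances of the anti-flexible identity with [R] applied to two of its three
    arguments: the outer two for the middle axiom, the first two for the other, where the
    Rota-Baxter identity turns [R] of a sum into a product. *)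

Theorem corollary4p4 (Omega : Type) (m : SemiGroup.com_law Omega)
    (K : fieldType) (charK0 : [pchar K] =i pred0) (A : vectType K)
    (op : Omega -> Omega -> A -> A -> A) (R : Omega -> A -> A)
    (hA : relative_antiflexible m op) (hR : relative_Rota_Baxter m op R) :
  relative_pre_antiflexible m
    (fun (a b : Omega) (x y : A) => op a b x (R b y))
    (fun (a b : Omega) (x y : A) => op a b (R a x) y).
Proof.
case: hA => opB opA; case: hR => RL RB.
split=> /=.
- move=> a b; have [opl opr] := opB a b; split=> [y|x] k u v /=.
    exact: opl.
  by rewrite RL; exact: opr.
- move=> a b; have [opl opr] := opB a b; split=> [y|x] k u v /=.
    by rewrite RL; exact: opl.
  exact: opr.
- by move=> a b c x y z; exact: opA.
- move=> a b c x y z.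
  (* The swaps put both sums in the order of [RB]; what remains is [opA] at [R a x], [R b y],
     [z]. *)
  by rewrite [op a b x _ + _]addrC [op b a y _ + _]addrC -!RB opA.
Qed.
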